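(* Let $T,M,L>0$, $\mu=M/L$, and let $F\in C^{\infty}_{0}([0,L]\times\mathbb{R})$ be a solution to the wave equation $\frac{\partial^{2}F}{\partial t^{2}}=\frac{T}{\mu}\frac{\partial^{2}F}{\partial x^{2}}$. Then there exist constants $K_m,L_m\in\mathbb{R}$ $(m\in\mathbb{Z}_{>0})$ such that the (time dependent) Fourier series expansion of $F$ is given by $$\sum_{m\in\mathbb{Z}_{>0}}\left(K_{m}\cos\Big(\frac{\pi m\sqrt{T}\,t}{L\sqrt{\mu}}\Big)\sin\Big(\frac{\pi xm}{L}\Big)+L_{m}\sin\Big(\frac{\pi m\sqrt{T}\,t}{L\sqrt{\mu}}\Big)\sin\Big(\frac{\pi xm}{L}\Big)\right),$$ and, for every $t\in\mathbb{R}$, this series converges uniformly in $x\in[0,L]$ to $F(\cdot,t)$.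
   Context: Functions are real-valued. $C^{\infty}([0,L]\times\mathbb{R})$ is the set of $F\in C([0,L]\times\mathbb{R})$ such that $F|_{(0,L)\times\mathbb{R}}$ is $C^{\infty}$ and, for every $i\ge 0$, there is $r_i\in C([0,L]\times\mathbb{R})$ with $r_i|_{(0,L)\times\mathbb{R}}=\frac{\partial^i F}{\partial x^i}$. $C^{\infty}_0([0,L]\times\mathbb{R})$ is the set of $F\in C^{\infty}([0,L]\times\mathbb{R})$ with $F(0,t)=F(L,t)=0$ for all $t\in\mathbb{R}$. Here $T,M,L$ are the tension, mass and length of a string and $\mu=M/L$ is the mass per unit length. A solution to the wave equation means an $F\in C^{\infty}_0([0,L]\times\mathbb{R})$ satisfying $\frac{\partial^{2}F}{\partial t^{2}}=\frac{T}{\mu}\frac{\partial^{2}F}{\partial x^{2}}$ on $(0,L)\times\mathbb{R}$. The Fourier series of $F$ at time $t$ is the series $\sum_{m\in\mathbb{Z}_{>0}}f_m(t)\sin(\pi xm/L)$ with $f_m(t)=\frac{2}{L}\int_0^L F(x,t)\sin(\pi xm/L)\,dx$ (that is, the Fourier series on $[-L,L]$ of the odd extension of $F(\cdot,t)$). *)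

(* Defs.v *)
From Stdlib Require Import Reals.
From Coquelicot Require Import Coquelicot.
Open Scope R_scope.

(* Functions on [0,L] x R are represented by total functions R -> R -> R
   (position first, time second) whose values outside the strip are
   irrelevant: continuity is relative to the closed strip, and derivatives
   are taken only at points of the open strip. *)
Definition closed_strip (L : R) (p : R * R) : Prop := 0 <= fst p <= L.

Definition continuous_on_strip (L : R) (F : R -> R -> R) : Prop :=
  continuous_on (closed_strip L) (fun p : R * R => F (fst p) (snd p)).

(* Coquelicot's [ex_diff_n F n x t] says that all iterated mixed partial
   derivatives of [F] of order at most [n] exist and are continuous at (x,t). *)
Definition smooth_on_open_strip (L : R) (F : R -> R -> R) : Prop :=
  forall (n : nat) (x t : R), 0 < x < L -> ex_diff_n F n x t.

(* In [partial_derive i j F x t], [i] counts derivatives in the first variable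
   and [j] those in the second one. *)
Definition smooth_strip (L : R) (F : R -> R -> R) : Prop :=
  continuous_on_strip L F /\
  smooth_on_open_strip L F /\
  forall i : nat, exists r : R -> R -> R,
    continuous_on_strip L r /\
    forall x t : R, 0 < x < L -> r x t = partial_derive i 0 F x t.

Definition smooth_strip0 (L : R) (F : R -> R -> R) : Prop :=
  smooth_strip L F /\ forall t : R, F 0 t = 0 /\ F L t = 0.

Definition wave_solution (T mu L : R) (F : R -> R -> R) : Prop :=
  smooth_strip0 L F /\
  forall x t : R, 0 < x < L ->
    partial_derive 0 2 F x t = T / mu * partial_derive 2 0 F x t.

Definition fourier_coef (L : R) (F : R -> R -> R) (m : nat) (t : R) : R :=
  2 / L * RInt (fun x => F x t * sin (PI * x * INR m / L)) 0 L.

Definition fourier_term (L : R) (F : R -> R -> R) (m : nat) (x t : R) : R :=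
  fourier_coef L F m t * sin (PI * x * INR m / L).

Definition standing_wave (T mu L Km Lm : R) (m : nat) (x t : R) : R :=
  Km * cos (PI * INR m * sqrt T * t / (L * sqrt mu)) * sin (PI * x * INR m / L)
  + Lm * sin (PI * INR m * sqrt T * t / (L * sqrt mu)) * sin (PI * x * INR m / L).

(* Coquelicot's [CVU_dom] leaves the limit function implicit; here it is
   explicit. *)
Definition converges_uniformly_on (D : R -> Prop)
    (fn : nat -> R -> R) (f : R -> R) : Prop :=
  forall eps : posreal,
    eventually (fun n => forall x : R, D x -> Rabs (fn n x - f x) < eps).

(* Main.v *)
Require Import Defs.
From Stdlib Require Import Reals Lra Lia.
From Coquelicot Require Import Coquelicot.
Open Scope R_scope.

(** The [m]-th Fourier coefficient of a solution is a harmonic oscillator in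
    time. Multiply the wave equation by the [m]-th sine and integrate over
    [[0, L]]: the left side is the second time derivative of the coefficient
    (differentiation under the integral sign), and on the right side Green's
    formula [sine_integral_second_derivative] moves both space derivatives to
    the sine, without boundary terms since [F] and the sine vanish at the ends.
    So the coefficient satisfies [f'' = - w ^ 2 * f]
    ([fourier_coef_oscillates]), hence is a combination of [cos (w * t)] and
    [sin (w * t)] ([harmonic_oscillator]). The delicate point is at the ends of
    the string, where only the space derivatives of [F] are known to extend
    continuously: the second time derivative does too, being a multiple of the
    second space derivative, and a mean value argument gives the first one
    ([continuous_time_derivative]).

    At a fixed time, [F] is a function [g] on [[0, L]], vanishing at the ends,
    whose first two derivatives extend continuously. Its sine series converges
    to it at every interior point ([sine_series_pointwise]): after subtraction
    of a multiple of the first sine, [g] is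
    [cos (PI * y / L) - cos (PI * x / L)] times a continuous function [q] of
    [y], the partial sum at [x] telescopes to two consecutive sine coefficients
    of [q] ([sine_partial_sum_telescopes]), and these tend to 0
    ([riemann_lebesgue_sine]). Green's formula again shows that the [m]-th term
    is [O(1 / m ^ 2)] uniformly in [x], which makes the convergence uniform
    ([sine_series_uniform]). *)

(** * Calculus on an interval *)

Lemma continuous_Rmult (f g : R -> R) (x : R) :
  continuous f x -> continuous g x -> continuous (fun y => f y * g y) x.
Proof. exact (continuous_scal f g x). Qed.

Lemma continuous_ex_RInt (f : R -> R) (a b : R) :
  (forall x, continuous f x) -> ex_RInt f a b.
Proof. intros Hf; apply (ex_RInt_continuous (V := R_CompleteNormedModule)); auto. Qed.

Lemma RInt_Rplus (f g : R -> R) (a b : R) :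
  (forall x, continuous f x) -> (forall x, continuous g x) ->
  RInt (fun x => f x + g x) a b = RInt f a b + RInt g a b.
Proof.
  intros Hf Hg.
  apply (RInt_plus f g a b); apply continuous_ex_RInt; assumption.
Qed.

Lemma RInt_Rmult_l (f : R -> R) (a b l : R) :
  (forall x, continuous f x) ->
  RInt (fun x => l * f x) a b = l * RInt f a b.
Proof.
  intros Hf.
  apply (RInt_scal f a b l); apply continuous_ex_RInt; assumption.
Qed.

Lemma RInt_ext_on (f g : R -> R) (a b : R) :
  a <= b -> (forall x, a < x < b -> f x = g x) -> RInt f a b = RInt g a b.
Proof.
  intros Hab H; apply (RInt_ext (V := R_CompleteNormedModule)).
  rewrite Rmin_left, Rmax_right by lra; exact H.
Qed.

Lemma MVT_everywhere (f df : R -> R) (a b : R) :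
  (forall x, is_derive f x (df x)) ->
  exists c, Rmin a b <= c <= Rmax a b /\ f b - f a = df c * (b - a).
Proof.
  intros Hf; apply MVT_gen; intros x _; [apply Hf|].
  apply continuity_pt_filterlim.
  apply (ex_derive_continuous (V := R_NormedModule)); eexists; apply Hf.
Qed.

Lemma zero_derivative_const (f : R -> R) (a b : R) :
  a <= b -> (forall x, continuous f x) ->
  (forall x, a < x < b -> is_derive f x 0) -> f b = f a.
Proof.
  intros Hab Hc Hd.
  destruct (MVT_gen f a b (fun _ => 0)) as [c [_ Hc']].
  - rewrite Rmin_left, Rmax_right by lra; exact Hd.
  - intros x _; apply continuity_pt_filterlim, Hc.
  - lra.
Qed.

(** The fundamental theorem of calculus with the derivative known only in the
    open interval: this is all that a function on the strip provides at the
    two ends. The primitive of [w] and [W] have the same derivative inside,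
    and both are continuous up to the ends. *)
Lemma RInt_interior_derivative (W w : R -> R) (a b : R) :
  a <= b -> (forall x, continuous W x) -> (forall x, continuous w x) ->
  (forall x, a < x < b -> is_derive W x (w x)) ->
  RInt w a b = W b - W a.
Proof.
  intros Hab HW Hw Hd.
  assert (HI : forall x, is_derive (fun y => RInt w a y) x (w x)).
  { intros x; apply (is_derive_RInt w _ a x); [|apply Hw].
    apply filter_forall; intros y.
    apply (RInt_correct (V := R_CompleteNormedModule)), continuous_ex_RInt, Hw. }
  assert (H : RInt w a b - W b = RInt w a a - W a).
  { apply (zero_derivative_const (fun y => RInt w a y - W y)); [exact Hab| |].
    - intros x; apply (continuous_minus (fun y => RInt w a y) W); [|apply HW].
      apply (ex_derive_continuous (V := R_NormedModule)); eexists; apply HI.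
    - intros x Hx.
      replace 0 with (minus (w x) (w x)) by (unfold minus, plus, opp; simpl; ring).
      apply (is_derive_minus (fun y => RInt w a y) W); [apply HI|apply Hd, Hx]. }
  assert (H0 : RInt w a a = 0) by exact (RInt_point (V := R_CompleteNormedModule) a w).
  lra.
Qed.

(** * Extension from the closed strip to the plane *)

(** Composing with the projection of the line onto [[0, L]] turns a function
    continuous on the closed strip into one continuous on the whole plane,
    with the same values on the strip; the calculus lemmas, which ask for
    two-sided continuity, then apply without special cases at the ends. *)
Definition clamp (L x : R) : R := Rmax 0 (Rmin x L).

Lemma clamp_bounds (L x : R) : 0 <= L -> 0 <= clamp L x <= L.
Proof.
  intros HL; unfold clamp, Rmax, Rmin.
  repeat destruct Rle_dec; lra.
Qed.

Lemma clamp_id (L x : R) : 0 <= x <= L -> clamp L x = x.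
Proof.
  intros Hx; unfold clamp; rewrite Rmin_left, Rmax_right; lra.
Qed.

Lemma clamp_contraction (L x y : R) :
  Rabs (clamp L x - clamp L y) <= Rabs (x - y).
Proof.
  unfold clamp, Rmax, Rmin, Rabs.
  repeat destruct Rle_dec; repeat destruct Rcase_abs; lra.
Qed.

Lemma continuous_clamp (L x : R) : continuous (clamp L) x.
Proof.
  apply filterlim_locally; intros eps; exists eps; intros y Hy.
  apply Rle_lt_trans with (2 := Hy), clamp_contraction.
Qed.

Lemma continuous_clamped (L : R) (F : R -> R -> R) (p : R * R) :
  0 <= L -> continuous_on_strip L F ->
  continuous (fun p => F (clamp L (fst p)) (snd p)) p.
Proof.
  intros HL HF; destruct p as [x t].
  set (c := fun p : R * R => (clamp L (fst p), snd p)).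
  apply (filterlim_comp _ _ _ c (fun q : R * R => F (fst q) (snd q)) _
           (within (closed_strip L) (locally (c (x, t))))).
  - intros P HP.
    assert (Hc : continuous c (x, t)).
    { unfold c; apply (continuous_comp_2 (fun p : R * R => clamp L (fst p)) snd pair).
      - apply (continuous_comp fst (clamp L)); [apply continuous_fst|apply continuous_clamp].
      - apply continuous_snd.
      - apply continuous_ext with (fun p => p); [now intros []|apply continuous_id]. }
    specialize (Hc _ HP); unfold filtermap in *.
    apply filter_imp with (2 := Hc); intros q Hq; apply Hq.
    apply clamp_bounds, HL.
  - apply (HF (c (x, t))), clamp_bounds, HL.
Qed.

Lemma continuous_slice (u : R -> R -> R) (t x : R) :
  continuous (fun p : R * R => u (fst p) (snd p)) (x, t) ->
  continuous (fun y => u y t) x.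
Proof.
  intros H.
  apply (continuous_comp_2 (fun y : R => y) (fun _ => t) u x);
    [apply continuous_id|apply continuous_const|exact H].
Qed.

(** * Time derivatives and integrals with a parameter *)

(** If [u] and its second time derivative are jointly continuous, so is the
    first: by the mean value theorem the difference quotient of step [h] is
    within [B * h] of [u1], where [B] bounds [u2] near the point, so that [u1]
    is a locally uniform limit of continuous functions. This is how continuity
    of the first time derivative up to the boundary is obtained, the hypotheses
    on the solution giving it only for the space derivatives. *)
Lemma continuous_time_derivative (u u1 u2 : R -> R -> R) :
  (forall p, continuous (fun p : R * R => u (fst p) (snd p)) p) ->
  (forall p, continuous (fun p : R * R => u2 (fst p) (snd p)) p) ->
  (forall x t, is_derive (u x) t (u1 x t)) ->
  (forall x t, is_derive (u1 x) t (u2 x t)) ->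
  forall p, continuous (fun p : R * R => u1 (fst p) (snd p)) p.
Proof.
  intros Hu Hu2 Hd1 Hd2 [x0 t0].
  apply filterlim_locally; intros eps; simpl.
  set (B := Rabs (u2 x0 t0) + 1).
  assert (HB : 0 < B) by (unfold B; pose proof (Rabs_pos (u2 x0 t0)); lra).
  destruct (proj1 (filterlim_locally _ _) (Hu2 (x0, t0)) (mkposreal 1 Rlt_0_1))
    as [d Hd]; simpl in Hd.
  set (h := Rmin (d / 2) (eps / (4 * B))).
  pose proof (cond_pos d) as Hd0; pose proof (cond_pos eps) as He0.
  assert (Hh : 0 < h).
  { unfold h; apply Rmin_pos; [lra|].
    apply Rdiv_lt_0_compat; lra. }
  assert (Hhd : h <= d / 2) by apply Rmin_l.
  assert (HhB : B * h <= eps / 4).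
  { replace (eps / 4) with (B * (eps / (4 * B))) by (field; lra).
    apply Rmult_le_compat_l; [lra|apply Rmin_r]. }
  (* the difference quotient of step h is within B h of the derivative *)
  assert (Hq : forall x t, Rabs (x - x0) < d / 2 -> Rabs (t - t0) < d / 2 ->
             Rabs ((u x (t + h) - u x t) / h - u1 x t) <= eps / 4).
  { intros x t Hx Ht.
    destruct (MVT_everywhere (u x) (u1 x) t (t + h)) as [c [Hc Ec]]; [apply Hd1|].
    destruct (MVT_everywhere (u1 x) (u2 x) t c) as [e [He Ee]]; [apply Hd2|].
    rewrite Rmin_left, Rmax_right in Hc by lra.
    rewrite Rmin_left, Rmax_right in He by lra.
    rewrite Ec; replace (u1 x c * (t + h - t) / h - u1 x t) with (u1 x c - u1 x t)
      by (field; lra).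
    rewrite Ee, Rabs_mult, (Rabs_right (c - t)) by lra.
    apply Rle_trans with (2 := HhB), Rmult_le_compat; [apply Rabs_pos|lra| |lra].
    assert (H1 : Rabs (u2 x e - u2 x0 t0) < 1).
    { apply (Hd (x, e)); split; [change (Rabs (x - x0) < d); lra|].
      change (Rabs (e - t0) < d); apply Rabs_def2 in Ht; apply Rabs_def1; lra. }
    unfold B; pose proof (Rabs_triang_inv (u2 x e) (u2 x0 t0)); lra. }
  assert (Hcq : continuous (fun p : R * R =>
                 (u (fst p) (snd p + h) - u (fst p) (snd p)) / h) (x0, t0)).
  { apply (continuous_mult (fun p : R * R => u (fst p) (snd p + h) - u (fst p) (snd p))
             (fun _ => / h)); [|apply continuous_const].
    apply (continuous_minus (fun p : R * R => u (fst p) (snd p + h))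
             (fun p : R * R => u (fst p) (snd p))); [|apply Hu].
    apply (continuous_comp_2 fst (fun p : R * R => snd p + h) u); [apply continuous_fst| |apply Hu].
    apply (continuous_plus snd (fun _ => h)); [apply continuous_snd|apply continuous_const]. }
  assert (He4 : 0 < eps / 4) by lra.
  destruct (proj1 (filterlim_locally _ _) Hcq (mkposreal _ He4)) as [d' Hd']; simpl in Hd'.
  assert (Hm : 0 < Rmin (d / 2) d') by (apply Rmin_pos; [lra|apply cond_pos]).
  exists (mkposreal _ Hm); intros [x t] [Hx Ht]; simpl in *.
  change (Rabs (x - x0) < Rmin (d / 2) d') in Hx.
  change (Rabs (t - t0) < Rmin (d / 2) d') in Ht.
  pose proof (Rmin_l (d / 2) d'); pose proof (Rmin_r (d / 2) d').
  specialize (Hd' (x, t)); simpl in Hd'.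
  assert (H3 : Rabs ((u x (t + h) - u x t) / h - (u x0 (t0 + h) - u x0 t0) / h) < eps / 4).
  { apply Hd'; split; [change (Rabs (x - x0) < d')|change (Rabs (t - t0) < d')]; lra. }
  pose proof (Hq x t ltac:(lra) ltac:(lra)) as H4.
  assert (H5 : Rabs ((u x0 (t0 + h) - u x0 t0) / h - u1 x0 t0) <= eps / 4).
  { apply Hq; rewrite Rminus_diag, Rabs_R0; lra. }
  change (Rabs (u1 x t - u1 x0 t0) < eps).
  apply Rabs_def2 in H3; apply Rabs_le_between in H4; apply Rabs_le_between in H5.
  apply Rabs_def1; lra.
Qed.

Lemma is_derive_RInt_time (u u1 : R -> R -> R) (a b t : R) :
  (forall p, continuous (fun p : R * R => u (fst p) (snd p)) p) ->
  (forall p, continuous (fun p : R * R => u1 (fst p) (snd p)) p) ->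
  (forall x t, is_derive (u x) t (u1 x t)) ->
  is_derive (fun t => RInt (fun x => u x t) a b) t (RInt (fun x => u1 x t) a b).
Proof.
  intros Hu Hu1 Hd.
  assert (HD : forall x s, Derive (fun z => u x z) s = u1 x s)
    by (intros x s; apply is_derive_unique, Hd).
  rewrite <- (RInt_ext (V := R_CompleteNormedModule)
                (fun x => Derive (fun z => u x z) t)) by (intros; apply HD).
  apply (is_derive_RInt_param (fun t x => u x t) a b t).
  - apply filter_forall; intros s x _; eexists; apply Hd.
  - intros x _; apply continuity_2d_pt_filterlim.
    apply (continuous_ext (fun z : R * R => u1 (snd z) (fst z))
             (fun z : R * R => Derive (fun s => u (snd z) s) (fst z)) (t, x)).
    { intros z; symmetry; apply HD. }
    apply (continuous_comp_2 snd fst u1 (t, x)); [apply continuous_snd|apply continuous_fst|apply Hu1].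
  - apply filter_forall; intros s; apply continuous_ex_RInt; intros x.
    apply continuous_slice, Hu.
Qed.

(** Energy argument: the difference [g] of the two sides solves the same
    equation with zero initial data, so [w ^ 2 * g ^ 2 + g' ^ 2] is constant
    and vanishes at 0. *)
Lemma harmonic_oscillator (f f1 : R -> R) (w : R) :
  0 < w ->
  (forall t, is_derive f t (f1 t)) ->
  (forall t, is_derive f1 t (- w ^ 2 * f t)) ->
  forall t, f t = f 0 * cos (w * t) + f1 0 / w * sin (w * t).
Proof.
  intros Hw H1 H2 t.
  set (g := fun t => f t - (f 0 * cos (w * t) + f1 0 / w * sin (w * t))).
  set (g1 := fun t => f1 t - (- f 0 * w * sin (w * t) + f1 0 * cos (w * t))).
  assert (Hg : forall s, is_derive g s (g1 s)).
  { intros s; unfold g, g1; auto_derive; [eexists; apply H1|].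
    replace (Derive (fun x => f x) s) with (f1 s) by (symmetry; apply is_derive_unique, H1).
    field; lra. }
  assert (Hg1 : forall s, is_derive g1 s (- w ^ 2 * g s)).
  { intros s; unfold g, g1; auto_derive; [eexists; apply H2|].
    replace (Derive (fun x => f1 x) s) with (- w ^ 2 * f s)
      by (symmetry; apply is_derive_unique, H2).
    field; lra. }
  set (E := fun s => w ^ 2 * g s ^ 2 + g1 s ^ 2).
  assert (HE : forall s, is_derive E s 0).
  { intros s; unfold E; auto_derive.
    - split; [eexists; apply Hg|split; [eexists; apply Hg1|exact I]].
    - replace (Derive (fun x => g x) s) with (g1 s) by (symmetry; apply is_derive_unique, Hg).
      replace (Derive (fun x => g1 x) s) with (- w ^ 2 * g s)
        by (symmetry; apply is_derive_unique, Hg1).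
      ring. }
  assert (HE0 : E 0 = 0).
  { unfold E, g, g1; rewrite Rmult_0_r, cos_0, sin_0; ring. }
  assert (HEt : E t = 0).
  { destruct (MVT_everywhere E (fun _ => 0) 0 t HE) as [c [_ Hc]]; lra. }
  assert (Hgt : g t = 0).
  { unfold E in HEt; pose proof (pow2_ge_0 (g1 t)); pose proof (pow2_ge_0 (g t)).
    assert (0 < w ^ 2) by (apply pow_lt, Hw).
    assert (g t ^ 2 = 0) by nra.
    nra. }
  unfold g in Hgt; lra.
Qed.

(** * Sine integrals on an interval *)

Definition sine (L : R) (m : nat) (x : R) : R := sin (PI * x * INR m / L).

Definition wavenumber (L : R) (m : nat) : R := PI * INR m / L.

Definition sine_integral (L : R) (g : R -> R) (m : nat) : R :=
  RInt (fun x => g x * sine L m x) 0 L.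

Definition sine_partial_sum (L : R) (g : R -> R) (n : nat) (x : R) : R :=
  sum_n_m (fun m => 2 / L * sine_integral L g m * sine L m x) 1 n.

Lemma is_derive_sine (L : R) (m : nat) (x : R) :
  0 < L -> is_derive (sine L m) x (wavenumber L m * cos (PI * x * INR m / L)).
Proof.
  intros HL; unfold sine, wavenumber; auto_derive; [exact I|unfold Rdiv; ring].
Qed.

Lemma continuous_sine (L : R) (m : nat) (x : R) : 0 < L -> continuous (sine L m) x.
Proof.
  intros HL; apply (ex_derive_continuous (V := R_NormedModule)).
  eexists; apply is_derive_sine, HL.
Qed.

Lemma sine_left (L : R) (m : nat) : sine L m 0 = 0.
Proof.
  unfold sine; replace (PI * 0 * INR m / L) with 0 by (unfold Rdiv; ring).
  apply sin_0.
Qed.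

Lemma sine_right (L : R) (m : nat) : 0 < L -> sine L m L = 0.
Proof.
  intros HL; unfold sine.
  apply sin_eq_0_1; exists (Z.of_nat m); rewrite <- INR_IZR_INZ; field; lra.
Qed.

Lemma wavenumber_pos (L : R) (m : nat) :
  0 < L -> (1 <= m)%nat -> 0 < wavenumber L m.
Proof.
  intros HL Hm; unfold wavenumber; apply Rdiv_lt_0_compat; [|exact HL].
  apply Rmult_lt_0_compat; [apply PI_RGT_0|apply lt_0_INR; lia].
Qed.

Lemma continuous_mult_sine (L : R) (g : R -> R) (m : nat) (x : R) :
  0 < L -> (forall x, continuous g x) -> continuous (fun x => g x * sine L m x) x.
Proof.
  intros HL Hg; apply continuous_Rmult; [apply Hg|apply continuous_sine, HL].
Qed.

(** Green's formula: [g1 * sine - g * sine'] is a primitive of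
    [g2 * sine - g * sine''], and it vanishes at both ends because [sine] and
    [g] do. It is used three times: for orthogonality of the sines, for the
    decay of the coefficients, and to turn the wave equation into an ordinary
    differential equation. *)
Lemma sine_integral_second_derivative (L : R) (g g1 g2 : R -> R) (m : nat) :
  0 < L ->
  (forall x, continuous g x) -> (forall x, continuous g1 x) ->
  (forall x, continuous g2 x) ->
  (forall x, 0 < x < L -> is_derive g x (g1 x)) ->
  (forall x, 0 < x < L -> is_derive g1 x (g2 x)) ->
  g 0 = 0 -> g L = 0 ->
  sine_integral L g2 m = - wavenumber L m ^ 2 * sine_integral L g m.
Proof.
  intros HL Hg Hg1 Hg2 Hd1 Hd2 H0 HL0.
  set (k := wavenumber L m).
  set (c := fun x => cos (PI * x * INR m / L)).
  assert (Hc : forall x, is_derive c x (- k * sine L m x)).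
  { intros x; unfold c, k, wavenumber, sine; auto_derive; [exact I|unfold Rdiv; ring]. }
  set (W := fun x => g1 x * sine L m x - k * (g x * c x)).
  set (w := fun x => g2 x * sine L m x + k ^ 2 * (g x * sine L m x)).
  assert (HI : RInt w 0 L = W L - W 0).
  { apply RInt_interior_derivative; [lra| | |].
    - intros x; unfold W.
      apply (continuous_minus (fun x => g1 x * sine L m x) (fun x => k * (g x * c x))).
      + apply continuous_mult_sine; assumption.
      + apply continuous_Rmult; [apply continuous_const|].
        apply continuous_Rmult; [apply Hg|].
        apply (ex_derive_continuous (V := R_NormedModule)); eexists; apply Hc.
    - intros x; unfold w.
      apply (continuous_plus (fun x => g2 x * sine L m x) (fun x => k ^ 2 * (g x * sine L m x))).
      + apply continuous_mult_sine; assumption.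
      + apply continuous_Rmult; [apply continuous_const|].
        apply continuous_mult_sine; assumption.
    - intros x Hx; unfold W, w.
      pose proof (is_derive_sine L m x HL) as Hs; fold k in Hs.
      auto_derive.
      + repeat split; eexists; [apply Hd2, Hx|apply Hs|apply Hd1, Hx|apply Hc].
      + replace (Derive (fun x => g1 x) x) with (g2 x)
          by (symmetry; apply is_derive_unique, Hd2, Hx).
        replace (Derive (fun x => g x) x) with (g1 x)
          by (symmetry; apply is_derive_unique, Hd1, Hx).
        replace (Derive (fun x => sine L m x) x) with (k * c x)
          by (symmetry; apply is_derive_unique, Hs).
        replace (Derive (fun x => c x) x) with (- k * sine L m x)
          by (symmetry; apply is_derive_unique, Hc).
        ring. }
  unfold W in HI; rewrite H0, HL0, sine_left, sine_right in HI by exact HL.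
  unfold w in HI; rewrite RInt_Rplus, RInt_Rmult_l in HI.
  - unfold sine_integral; lra.
  - intros x; apply continuous_mult_sine; assumption.
  - intros x; apply continuous_mult_sine; assumption.
  - intros x; apply continuous_Rmult; [apply continuous_const|].
    apply continuous_mult_sine; assumption.
Qed.

Lemma is_derive2_sine (L : R) (m : nat) (x : R) :
  0 < L ->
  is_derive (fun x => wavenumber L m * cos (PI * x * INR m / L)) x
    (- wavenumber L m ^ 2 * sine L m x).
Proof.
  intros HL; unfold sine, wavenumber; auto_derive; [exact I|unfold Rdiv; ring].
Qed.

(** [sine L 1] is itself an eigenfunction of the second derivative, so Green's
    formula multiplies this integral by two different eigenvalues. *)
Lemma sine_orthogonal (L : R) (m : nat) :
  0 < L -> m <> 1%nat -> sine_integral L (sine L 1) m = 0.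
Proof.
  intros HL Hm.
  set (l := wavenumber L 1).
  assert (H : sine_integral L (fun x => - l ^ 2 * sine L 1 x) m
              = - wavenumber L m ^ 2 * sine_integral L (sine L 1) m).
  { apply sine_integral_second_derivative
      with (g1 := fun x => l * cos (PI * x * INR 1 / L)).
    - exact HL.
    - intros x; apply continuous_sine, HL.
    - intros x; apply (ex_derive_continuous (V := R_NormedModule)).
      eexists; apply is_derive2_sine, HL.
    - intros x; apply continuous_Rmult; [apply continuous_const|apply continuous_sine, HL].
    - intros x _; apply is_derive_sine, HL.
    - intros x _; apply is_derive2_sine, HL.
    - apply sine_left.
    - apply sine_right, HL. }
  assert (E : sine_integral L (fun x => - l ^ 2 * sine L 1 x) m
              = - l ^ 2 * sine_integral L (sine L 1) m).
  { unfold sine_integral; rewrite <- RInt_Rmult_l.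
    - apply (RInt_ext (V := R_CompleteNormedModule)); intros x _; cbv beta.
      change (- l ^ 2 * sine L 1 x * sine L m x = - l ^ 2 * (sine L 1 x * sine L m x)); ring.
    - intros x; apply continuous_mult_sine; [exact HL|intros y; apply continuous_sine, HL]. }
  rewrite E in H.
  assert (Hl : wavenumber L m = INR m * l).
  { unfold l, wavenumber; simpl INR; field; lra. }
  assert (Hl0 : 0 < l) by (apply wavenumber_pos; [exact HL|lia]).
  rewrite Hl in H.
  assert (Hm1 : INR m ^ 2 <> 1).
  { intros Hm2; apply Hm, INR_eq; simpl INR; pose proof (pos_INR m); nra. }
  assert (Hz : (INR m ^ 2 - 1) * (l ^ 2 * sine_integral L (sine L 1) m) = 0) by lra.
  apply Rmult_integral in Hz; destruct Hz as [Hz|Hz]; [lra|].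
  apply Rmult_integral in Hz; destruct Hz as [Hz|Hz]; [|exact Hz].
  pose proof (pow_lt l 2 Hl0); lra.
Qed.

Lemma sine_norm (L : R) : 0 < L -> sine_integral L (sine L 1) 1 = L / 2.
Proof.
  intros HL; unfold sine_integral.
  set (W := fun x => x / 2 - L / (4 * PI) * sin (2 * (PI * x * INR 1 / L))).
  pose proof PI_RGT_0 as HP.
  assert (HW : forall x, is_derive W x (sine L 1 x * sine L 1 x)).
  { intros x; unfold W, sine; auto_derive; [exact I|].
    change (INR 1) with 1.
    replace (PI * x * 1 * / L) with (PI * x * 1 / L) by reflexivity.
    rewrite cos_2a_sin; field; lra. }
  rewrite (RInt_interior_derivative W).
  - unfold W; change (INR 1) with 1.
    replace (2 * (PI * L * 1 / L)) with (2 * PI) by (field; lra).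
    replace (2 * (PI * 0 * 1 / L)) with 0 by (field; lra).
    rewrite sin_2PI, sin_0; field; lra.
  - lra.
  - intros x; apply (ex_derive_continuous (V := R_NormedModule)); eexists; apply HW.
  - intros x; apply continuous_mult_sine; [exact HL|intros y; apply continuous_sine, HL].
  - intros x _; apply HW.
Qed.

(** * Telescoping of the partial sums and the Riemann-Lebesgue lemma *)

Lemma sine_recurrence (L : R) (m : nat) (x : R) :
  sine L (S (S m)) x + sine L m x = 2 * cos (PI * x / L) * sine L (S m) x.
Proof.
  unfold sine.
  replace (PI * x * INR (S (S m)) / L) with (PI * x * INR (S m) / L + PI * x / L)
    by (rewrite (S_INR (S m)); unfold Rdiv; ring).
  replace (PI * x * INR m / L) with (PI * x * INR (S m) / L - PI * x / L)
    by (rewrite S_INR; unfold Rdiv; ring).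
  rewrite sin_plus, sin_minus; ring.
Qed.

Lemma continuous_cosine (L x : R) : continuous (fun y => cos (PI * y / L)) x.
Proof.
  apply (ex_derive_continuous (V := R_NormedModule)); auto_derive; exact I.
Qed.

(** The Christoffel-Darboux identity for the sines. Multiplication by
    [2 * cos (PI * y / L)] sends [sine m] to [sine (m + 1) + sine (m - 1)], so
    for a function divisible by [cos (PI * y / L) - cos (PI * x0 / L)] the
    partial sum at [x0] collapses to two sine coefficients of the quotient. *)
Lemma sine_partial_sum_telescopes (L : R) (q : R -> R) (x0 : R) (n : nat) :
  0 < L -> (forall x, continuous q x) ->
  let N := fun y => (cos (PI * y / L) - cos (PI * x0 / L)) * q y in
  sine_partial_sum L N n x0
  = (sine_integral L q (S n) * sine L n x0
     - sine_integral L q n * sine L (S n) x0) / L.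
Proof.
  intros HL Hq N; unfold sine_partial_sum.
  assert (HN : forall m, 2 * sine_integral L N (S m)
             = sine_integral L q (S (S m)) + sine_integral L q m
               - 2 * cos (PI * x0 / L) * sine_integral L q (S m)).
  { intros m; unfold sine_integral.
    assert (Hs : forall m x, continuous (fun x => q x * sine L m x) x)
      by (intros; apply continuous_mult_sine; assumption).
    assert (HNc : forall x, continuous N x).
    { intros x; apply continuous_Rmult; [|apply Hq].
      apply (continuous_minus (fun y => cos (PI * y / L)) (fun _ => cos (PI * x0 / L)));
        [apply continuous_cosine|apply continuous_const]. }
    unfold Rminus; rewrite Ropp_mult_distr_l.
    rewrite <- !RInt_Rmult_l, <- !RInt_Rplus; try assumption;
      try (intros x; apply continuous_mult_sine; assumption);
      try (intros x; apply (continuous_plus (fun y => q y * sine L (S (S m)) y)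
            (fun y => q y * sine L m y)); apply Hs);
      try (intros x; apply continuous_Rmult; [apply continuous_const|apply Hs]).
    apply (RInt_ext (V := R_CompleteNormedModule)); intros x _; unfold N.
    replace (sine L (S (S m)) x)
      with (2 * cos (PI * x / L) * sine L (S m) x - sine L m x)
      by (rewrite <- sine_recurrence; ring).
    change (2 * ((cos (PI * x / L) - cos (PI * x0 / L)) * q x * sine L (S m) x) =
      q x * (2 * cos (PI * x / L) * sine L (S m) x - sine L m x) + q x * sine L m x +
      - (2 * cos (PI * x0 / L)) * (q x * sine L (S m) x)).
    ring. }
  induction n as [|n IH].
  - rewrite sum_n_m_zero by lia; change (@zero _) with 0.
    assert (H0 : forall x, sine L 0 x = 0).
    { intros x; unfold sine; simpl INR; rewrite Rmult_0_r; unfold Rdiv.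
      rewrite Rmult_0_l; apply sin_0. }
    assert (Hz : sine_integral L q 0 = 0).
    { unfold sine_integral.
      rewrite (RInt_ext (V := R_CompleteNormedModule) _ (fun _ => 0)).
      - rewrite RInt_const; exact (Rmult_0_r _).
      - intros x _; rewrite H0; exact (Rmult_0_r _). }
    rewrite H0, Hz.
    match goal with |- ?a = ?b => change (@eq R a b) end; field; lra.
  - rewrite sum_n_Sm by lia; rewrite IH.
    match goal with |- plus ?a ?b = ?c => change (a + b = c) end.
    replace (2 / L * sine_integral L N (S n)) with (2 * sine_integral L N (S n) / L)
      by (field; lra).
    rewrite HN.
    replace (sine L (S (S n)) x0)
      with (2 * cos (PI * x0 / L) * sine L (S n) x0 - sine L n x0)
      by (rewrite <- sine_recurrence; ring).
    field; lra.
Qed.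

(** Shifting the variable by half a period [h = L / n] changes the sign of the
    sine, so twice the integral is the integral of [q y - q (y + h)] against
    the sine, small by uniform continuity, up to two pieces of length [h]. *)
Lemma riemann_lebesgue_sine (L : R) (q : R -> R) :
  0 < L -> (forall x, continuous q x) -> is_lim_seq (sine_integral L q) 0.
Proof.
  intros HL Hq.
  assert (Hqp : forall x, continuity_pt q x)
    by (intros x; apply continuity_pt_filterlim, Hq).
  destruct (continuity_ab_maj (fun x => Rabs (q x)) 0 (2 * L)) as [xm [Hxm _]]; [lra| |].
  { intros c _; apply continuity_pt_filterlim.
    apply (continuous_Rabs_comp q), Hq. }
  set (B := Rabs (q xm)).
  assert (HB : forall x, 0 <= x <= 2 * L -> Rabs (q x) <= B) by exact Hxm.
  assert (HB0 : 0 <= B) by apply Rabs_pos.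
  apply is_lim_seq_spec; intros eps; simpl.
  pose proof (cond_pos eps) as He.
  assert (He' : 0 < eps / (2 * L)) by (apply Rdiv_lt_0_compat; lra).
  destruct (@Heine_cor2 q 0 (2 * L) (fun x _ => Hqp x) (mkposreal _ He')) as [d Hd];
    simpl in Hd; pose proof (cond_pos d) as Hd0.
  assert (HN : exists N, (1 <= N)%nat /\ L / d < INR N /\ 4 * L * B / eps < INR N).
  { destruct (nfloor_ex (Rmax (L / d) (4 * L * B / eps))) as [N HN].
    - apply Rle_trans with (2 := Rmax_l _ _); apply Rlt_le, Rdiv_lt_0_compat; lra.
    - exists (S N); rewrite S_INR; split; [lia|].
      pose proof (Rmax_l (L / d) (4 * L * B / eps));
      pose proof (Rmax_r (L / d) (4 * L * B / eps)); lra. }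
  (* the two lower bounds on n give h < d and 4 * h * B < eps *)
  destruct HN as [N [HN1 [HNd HNe]]].
  exists N; intros n Hn; rewrite Rminus_0_r.
  assert (HnN : INR N <= INR n) by (apply le_INR; lia).
  assert (Hn0 : 1 <= INR n) by (apply (le_INR 1); lia).
  set (h := L / INR n).
  assert (Hh : 0 < h) by (apply Rdiv_lt_0_compat; lra).
  assert (HhL : h <= L).
  { unfold h; apply Rle_div_l; [lra|nra]. }
  assert (Hhd : h < d).
  { unfold h; apply Rlt_div_l; [lra|].
    assert (L / d < INR n) as H by lra; apply Rlt_div_l in H; lra. }
  assert (HhB : 4 * (h * B) < eps).
  { assert (4 * L * B / eps < INR n) as H by lra; apply Rlt_div_l in H; [|lra].
    unfold h; replace (4 * (L / INR n * B)) with (4 * L * B / INR n) by (field; lra).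
    apply Rlt_div_l; lra. }
  set (f := fun y => q y * sine L n y).
  assert (Hf : forall y, continuous f y)
    by (intros y; apply continuous_mult_sine; assumption).
  assert (Hshift : RInt (fun y => f (y + h)) 0 L = RInt f h (L + h)).
  { pose proof (RInt_comp_lin (V := R_CompleteNormedModule) f 1 h 0 L) as H.
    replace (1 * 0 + h) with h in H by ring; replace (1 * L + h) with (L + h) in H by ring.
    rewrite <- H by (apply continuous_ex_RInt, Hf).
    apply (RInt_ext (V := R_CompleteNormedModule)); intros y _.
    rewrite !Rmult_1_l; reflexivity. }
  assert (Hch : RInt f 0 h + RInt f h (L + h) = RInt f 0 L + RInt f L (L + h)).
  { transitivity (RInt f 0 (L + h));
      [|symmetry]; apply (RInt_Chasles (V := R_CompleteNormedModule));
      apply continuous_ex_RInt, Hf. }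
  assert (Hqh : forall y, continuous (fun y => q (y + h)) y).
  { intros y; apply (continuous_comp (fun y => y + h) q); [|apply Hq].
    apply (continuous_plus (fun y => y) (fun _ => h));
      [apply continuous_id|apply continuous_const]. }
  assert (Hfh : forall y, f y + f (y + h) = (q y - q (y + h)) * sine L n y).
  { intros y; unfold f, sine, h.
    replace (PI * (y + L / INR n) * INR n / L) with (PI * y * INR n / L + PI)
      by (field; lra).
    rewrite neg_sin; ring. }
  assert (Hsum : RInt f 0 L + RInt f h (L + h)
                 = RInt (fun y => (q y - q (y + h)) * sine L n y) 0 L).
  { rewrite <- Hshift, <- RInt_Rplus.
    - apply (RInt_ext (V := R_CompleteNormedModule)); intros y _; apply Hfh.
    - exact Hf.
    - intros y; apply (continuous_comp (fun y => y + h) f); [|apply Hf].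
      apply (continuous_plus (fun y => y) (fun _ => h));
        [apply continuous_id|apply continuous_const]. }
  assert (Hsin : forall y, Rabs (sine L n y) <= 1)
    by (intros y; apply Rabs_le, SIN_bound).
  assert (Hmid : Rabs (RInt (fun y => (q y - q (y + h)) * sine L n y) 0 L)
                 <= (L - 0) * (eps / (2 * L))).
  { apply abs_RInt_le_const; [lra| |].
    - apply continuous_ex_RInt; intros y; apply continuous_mult_sine; [exact HL|].
      intros z; apply (continuous_minus q (fun y => q (y + h))); [apply Hq|apply Hqh].
    - intros y Hy; rewrite Rabs_mult, <- (Rmult_1_r (eps / (2 * L))).
      apply Rmult_le_compat; [apply Rabs_pos|apply Rabs_pos| |apply Hsin].
      apply Rlt_le, Hd; [lra|lra|].
      replace (y - (y + h)) with (- h) by ring; rewrite Rabs_Ropp, Rabs_right; lra. }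
  assert (Hend : forall a, 0 <= a <= L -> Rabs (RInt f a (a + h)) <= h * B).
  { intros a Ha; replace (h * B) with ((a + h - a) * B) by ring.
    apply abs_RInt_le_const; [lra|apply continuous_ex_RInt, Hf|].
    intros y Hy; unfold f; rewrite Rabs_mult, <- (Rmult_1_r B).
    apply Rmult_le_compat; [apply Rabs_pos|apply Rabs_pos| |apply Hsin].
    apply HB; lra. }
  pose proof (Hend 0 ltac:(lra)) as H1; pose proof (Hend L ltac:(lra)) as H2.
  rewrite Rplus_0_l in H1.
  replace ((L - 0) * (eps / (2 * L))) with (eps / 2) in Hmid by (field; lra).
  rewrite <- Hsum in Hmid.
  change (sine_integral L q n) with (RInt f 0 L).
  apply Rabs_le_between in Hmid; apply Rabs_le_between in H1; apply Rabs_le_between in H2.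
  apply Rabs_def1; lra.
Qed.

(** * Convergence of sine series *)

(** The difference quotient of [f] at [x0], extended by [d], meant to be
    the derivative of [f] at [x0], at the point itself. *)
Definition slope (f : R -> R) (x0 d y : R) : R :=
  if Req_dec_T y x0 then d else (f y - f x0) / (y - x0).

Lemma continuous_slope (f : R -> R) (x0 d x : R) :
  (forall y, continuous f y) -> is_derive f x0 d -> continuous (slope f x0 d) x.
Proof.
  intros Hf Hd; destruct (Req_dec_T x x0) as [->|Hx].
  - apply filterlim_locally; intros eps.
    apply is_derive_Reals in Hd.
    destruct (Hd eps (cond_pos eps)) as [e He].
    exists e; intros y Hy; change (Rabs (slope f x0 d y - slope f x0 d x0) < eps).
    change (Rabs (y - x0) < e) in Hy; unfold slope.
    destruct (Req_dec_T x0 x0) as [_|n]; [|now destruct n].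
    destruct (Req_dec_T y x0) as [_|Hyx].
    + rewrite Rminus_diag, Rabs_R0; apply cond_pos.
    + replace (f y) with (f (x0 + (y - x0))) by (f_equal; ring).
      apply He; [lra|exact Hy].
  - assert (Hpos : 0 < Rabs (x - x0)) by (apply Rabs_pos_lt; lra).
    apply (continuous_ext_loc _ (fun y => (f y - f x0) / (y - x0))).
    + exists (mkposreal _ Hpos); intros y Hy; unfold slope.
      change (Rabs (y - x) < Rabs (x - x0)) in Hy.
      destruct (Req_dec_T y x0) as [->|_]; [|reflexivity].
      rewrite Rabs_minus_sym in Hy; lra.
    + apply continuous_Rmult.
      * apply (continuous_minus f (fun _ => f x0)); [apply Hf|apply continuous_const].
      * apply (continuous_comp (fun y => y - x0) Rinv).
        -- apply (continuous_minus (fun y => y) (fun _ => x0));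
             [apply continuous_id|apply continuous_const].
        -- apply continuous_Rinv; lra.
Qed.

(** Both functions vanish at [x0], so their quotient is the quotient of their
    difference quotients at [x0]; the one of the cosine has no zero on
    [[0, L]] because the cosine is injective there and its derivative at the
    interior point [x0] is not zero. Clamping makes the quotient continuous on
    the whole line. *)
Lemma divisible_by_cosine_difference (L : R) (f : R -> R) (x0 d : R) :
  0 < x0 < L -> (forall x, continuous f x) -> is_derive f x0 d -> f x0 = 0 ->
  exists q : R -> R, (forall x, continuous q x) /\
    forall y, 0 <= y <= L -> f y = (cos (PI * y / L) - cos (PI * x0 / L)) * q y.
Proof.
  intros Hx0 Hf Hd H0.
  pose proof PI_RGT_0 as HP.
  assert (Hang : forall y, 0 <= y <= L -> 0 <= PI * y / L <= PI).
  { intros y Hy; split.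
    - apply Rmult_le_pos; [nra|apply Rlt_le, Rinv_0_lt_compat; lra].
    - apply Rle_div_l; [lra|nra]. }
  set (c := fun y => cos (PI * y / L)).
  set (d' := - (PI / L) * sin (PI * x0 / L)).
  assert (Hd' : d' <> 0).
  { assert (0 < PI / L) by (apply Rdiv_lt_0_compat; lra).
    assert (0 < sin (PI * x0 / L)).
    { apply sin_gt_0; [apply Rdiv_lt_0_compat; nra|apply Rlt_div_l; nra]. }
    unfold d'; nra. }
  assert (Hc : is_derive c x0 d').
  { unfold c, d'; auto_derive; [exact I|unfold Rdiv; ring]. }
  assert (Hne : forall y, 0 <= y <= L -> y <> x0 -> c y - c x0 <> 0).
  { intros y Hy Hyx Heq.
    assert (He : PI * y / L = PI * x0 / L).
    { apply cos_inj; [apply Hang, Hy|apply Hang; lra|unfold c in Heq; lra]. }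
    apply Hyx; apply (f_equal (fun z => z * (L / PI))) in He.
    field_simplify in He; [exact He|lra|lra]. }
  assert (Hslope : forall y, 0 <= y <= L -> slope c x0 d' y <> 0).
  { intros y Hy; unfold slope; destruct (Req_dec_T y x0) as [_|Hyx]; [exact Hd'|].
    apply Rmult_integral_contrapositive_currified; [apply Hne; assumption|].
    apply Rinv_neq_0_compat; lra. }
  exists (fun y => slope f x0 d (clamp L y) / slope c x0 d' (clamp L y)); split.
  - intros x; apply continuous_Rmult.
    + apply (continuous_comp (clamp L) (slope f x0 d)); [apply continuous_clamp|].
      apply continuous_slope; assumption.
    + apply (continuous_comp (fun y => slope c x0 d' (clamp L y)) Rinv).
      * apply (continuous_comp (clamp L) (slope c x0 d')); [apply continuous_clamp|].
        apply continuous_slope; [intros y; apply continuous_cosine|exact Hc].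
      * apply continuous_Rinv, Hslope, clamp_bounds; lra.
  - intros y Hy; rewrite clamp_id by exact Hy.
    pose proof (Hslope y Hy) as Hs; pose proof (Hne y Hy) as Hn.
    fold (c y) (c x0).
    unfold slope in *; destruct (Req_dec_T y x0) as [->|Hyx].
    + rewrite H0; ring.
    + specialize (Hn Hyx); rewrite H0; field; split; lra.
Qed.

Lemma sine_partial_sum_of_sine (L x : R) (n : nat) :
  0 < L -> (1 <= n)%nat -> sine_partial_sum L (sine L 1) n x = sine L 1 x.
Proof.
  intros HL Hn; unfold sine_partial_sum.
  rewrite sum_Sn_m by exact Hn.
  rewrite (sum_n_m_ext_loc _ (fun _ => zero) 2 n).
  - rewrite sum_n_m_const_zero, plus_zero_r, sine_norm by exact HL.
    match goal with |- ?a = ?b => change (@eq R a b) end; field; lra.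
  - intros m Hm; rewrite sine_orthogonal by (exact HL || lia).
    change (2 / L * 0 * sine L m x = 0); ring.
Qed.

Lemma sine_partial_sum_decompose (L c x : R) (g f : R -> R) (n : nat) :
  0 < L -> (forall x, continuous f x) ->
  (forall y, 0 <= y <= L -> g y = c * sine L 1 y + f y) ->
  sine_partial_sum L g n x
  = c * sine_partial_sum L (sine L 1) n x + sine_partial_sum L f n x.
Proof.
  intros HL Hf Hg; unfold sine_partial_sum.
  match goal with |- ?a = ?b => change (@eq R a b) end.
  rewrite <- (sum_n_m_mult_l (K := R_Ring) c).
  match goal with |- _ = ?a + ?b => change (a + b) with (plus a b) end.
  rewrite <- (sum_n_m_plus (G := R_AbelianMonoid)).
  apply sum_n_m_ext; intros m.
  assert (Hm : sine_integral L g m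
               = c * sine_integral L (sine L 1) m + sine_integral L f m).
  { unfold sine_integral.
    assert (Hs : forall y, continuous (fun x => sine L 1 x * sine L m x) y)
      by (intros y; apply continuous_mult_sine; [|intros z; apply continuous_sine]; exact HL).
    rewrite <- RInt_Rmult_l, <- RInt_Rplus; [|intros y|intros y|exact Hs].
    - apply RInt_ext_on; [lra|intros y Hy; rewrite Hg by lra; ring].
    - apply continuous_Rmult; [apply continuous_const|apply Hs].
    - apply continuous_mult_sine; assumption. }
  rewrite Hm.
  change (2 / L * (c * sine_integral L (sine L 1) m + sine_integral L f m) * sine L m x
          = c * (2 / L * sine_integral L (sine L 1) m * sine L m x)
            + 2 / L * sine_integral L f m * sine L m x); ring.
Qed.

(** Subtract from [g] the multiple of the first sine that has the same value at
    [x0]. The first sine is its own sine series, and the remainder vanishes at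
    [x0], hence is divisible by [cos (PI * y / L) - cos (PI * x0 / L)] with
    continuous quotient; by Christoffel-Darboux its partial sums at [x0] are
    combinations of consecutive sine coefficients of the quotient, which tend
    to 0 by Riemann-Lebesgue. *)
Lemma sine_series_pointwise (L : R) (g : R -> R) (x0 d : R) :
  0 < x0 < L -> (forall x, continuous g x) -> is_derive g x0 d ->
  is_lim_seq (fun n => sine_partial_sum L g n x0) (g x0).
Proof.
  intros Hx0 Hg Hd.
  assert (HL : 0 < L) by lra.
  pose proof PI_RGT_0 as HP.
  assert (Hs : 0 < sine L 1 x0).
  { unfold sine; change (INR 1) with 1; rewrite Rmult_1_r.
    apply sin_gt_0; [apply Rdiv_lt_0_compat; nra|apply Rlt_div_l; nra]. }
  set (c := g x0 / sine L 1 x0).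
  set (f := fun y => g y - c * sine L 1 y).
  assert (Hcf : forall x, continuous f x).
  { intros x; apply (continuous_minus g (fun y => c * sine L 1 y)); [apply Hg|].
    apply continuous_Rmult; [apply continuous_const|apply continuous_sine, HL]. }
  assert (Hdf : ex_derive f x0).
  { apply (ex_derive_minus g (fun y => c * sine L 1 y)); [eexists; exact Hd|].
    apply ex_derive_scal; eexists; apply is_derive_sine, HL. }
  destruct Hdf as [df Hdf].
  destruct (divisible_by_cosine_difference L f x0 df) as [q [Hq Hfq]];
    [exact Hx0|exact Hcf|exact Hdf|unfold f, c; field; lra|].
  set (N := fun y => (cos (PI * y / L) - cos (PI * x0 / L)) * q y) in Hfq.
  assert (HcN : forall x, continuous N x).
  { intros x; apply continuous_Rmult; [|apply Hq].
    apply (continuous_minus (fun y => cos (PI * y / L)) (fun _ => cos (PI * x0 / L)));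
      [apply continuous_cosine|apply continuous_const]. }
  assert (HS : forall n, (1 <= n)%nat -> sine_partial_sum L g n x0 - g x0
     = (sine_integral L q (S n) * sine L n x0
        - sine_integral L q n * sine L (S n) x0) / L).
  { intros n Hn.
    rewrite (sine_partial_sum_decompose L c x0 g N n HL HcN).
    - rewrite sine_partial_sum_of_sine by assumption.
      rewrite <- (sine_partial_sum_telescopes L q x0 n HL Hq).
      unfold c; fold N; field; lra.
    - intros y Hy; specialize (Hfq y Hy); fold (N y) in Hfq; unfold f in Hfq; lra. }
  pose proof (riemann_lebesgue_sine L q HL Hq) as HRL.
  assert (Hsin : forall m, Rabs (sine L m x0) <= 1)
    by (intros m; apply Rabs_le, SIN_bound).
  apply is_lim_seq_spec; intros eps; pose proof (cond_pos eps) as He.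
  assert (He' : 0 < eps * L / 2) by nra.
  apply is_lim_seq_spec in HRL.
  destruct (HRL (mkposreal _ He')) as [M HM]; simpl in HM.
  exists (S M); intros n Hn; rewrite HS by lia.
  pose proof (HM n ltac:(lia)) as H1; pose proof (HM (S n) ltac:(lia)) as H2.
  rewrite Rminus_0_r in H1, H2.
  unfold Rdiv; rewrite Rabs_mult, (Rabs_right (/ L))
    by (apply Rle_ge, Rlt_le, Rinv_0_lt_compat, HL).
  apply Rlt_div_l; [exact HL|].
  apply Rle_lt_trans with (1 := Rabs_triang _ _).
  rewrite Rabs_Ropp, !Rabs_mult.
  pose proof (Hsin n); pose proof (Hsin (S n)).
  pose proof (Rabs_pos (sine_integral L q n)); pose proof (Rabs_pos (sine_integral L q (S n))).
  nra.
Qed.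

Lemma sine_partial_sum_at_node (L : R) (g : R -> R) (x : R) (n : nat) :
  (forall m, sine L m x = 0) -> sine_partial_sum L g n x = 0.
Proof.
  intros Hx; unfold sine_partial_sum.
  rewrite (sum_n_m_ext _ (fun _ => zero)); [apply (sum_n_m_const_zero (G := R_AbelianMonoid))|].
  intros m; rewrite Hx; exact (Rmult_0_r _).
Qed.

(** The comparison [1 / (x + 1) ^ 2 <= 1 / x - 1 / (x + 1)] makes the bound
    telescope. *)
Lemma inverse_square_tail (a : nat -> R) (D : R) (n p : nat) :
  0 <= D -> (1 <= n)%nat ->
  (forall m, (1 <= m)%nat -> Rabs (a m) <= D / INR m ^ 2) ->
  Rabs (sum_n_m a 1 (n + p) - sum_n_m a 1 n) <= D * (/ INR n - / INR (n + p)).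
Proof.
  intros HD Hn Ha; induction p as [|p IH].
  - rewrite Nat.add_0_r, !Rminus_diag, Rabs_R0; lra.
  - rewrite Nat.add_succ_r, (sum_n_Sm a) by lia.
    change (plus ?x ?y) with (x + y).
    specialize (Ha (S (n + p)) ltac:(lia)); rewrite S_INR in *.
    assert (Hx : 1 <= INR (n + p)) by (apply (le_INR 1); lia).
    set (x := INR (n + p)) in *.
    assert (Hb : D / (x + 1) ^ 2 <= D * (/ x - / (x + 1))).
    { unfold Rdiv; apply Rmult_le_compat_l; [exact HD|].
      replace (/ x - / (x + 1)) with (/ (x * (x + 1))) by (field; lra).
      apply Rinv_le_contravar; nra. }
    match goal with |- Rabs (?s + ?y - ?z) <= _ =>
      replace (s + y - z) with ((s - z) + y) by ring end.
    apply Rle_trans with (1 := Rabs_triang _ _); lra.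
Qed.

(** By Green's formula the [m]-th term is at most [D / m ^ 2], uniformly in [x],
    so the partial sums differ from one another by at most [D / n] after rank
    [n]; the pointwise limit, already known to be [g], inherits this bound. *)
Lemma sine_series_uniform (L : R) (g g1 g2 : R -> R) :
  0 < L ->
  (forall x, continuous g x) -> (forall x, continuous g1 x) ->
  (forall x, continuous g2 x) ->
  (forall x, 0 < x < L -> is_derive g x (g1 x)) ->
  (forall x, 0 < x < L -> is_derive g1 x (g2 x)) ->
  g 0 = 0 -> g L = 0 ->
  converges_uniformly_on (fun x => 0 <= x <= L) (sine_partial_sum L g) g.
Proof.
  intros HL Hg Hg1 Hg2 Hd1 Hd2 H0 HL0.
  pose proof PI_RGT_0 as HP.
  destruct (continuity_ab_maj (fun x => Rabs (g2 x)) 0 L) as [xm [Hxm _]]; [lra| |].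
  { intros c _; apply continuity_pt_filterlim.
    apply (continuous_Rabs_comp g2), Hg2. }
  set (B := Rabs (g2 xm)).
  assert (HB0 : 0 <= B) by apply Rabs_pos.
  assert (Hsin : forall m x, Rabs (sine L m x) <= 1)
    by (intros m x; apply Rabs_le, SIN_bound).
  set (D := 2 * B * L ^ 2 / PI ^ 2).
  assert (HD : 0 <= D).
  { apply Rmult_le_pos; [nra|apply Rlt_le, Rinv_0_lt_compat; nra]. }
  assert (Hterm : forall x m, (1 <= m)%nat ->
    Rabs (2 / L * sine_integral L g m * sine L m x) <= D / INR m ^ 2).
  { intros x m Hm.
    pose proof (wavenumber_pos L m HL Hm) as Hk.
    assert (Hm1 : 1 <= INR m) by (apply (le_INR 1), Hm).
    assert (HI : Rabs (sine_integral L g2 m) <= (L - 0) * B).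
    { apply abs_RInt_le_const; [lra| |].
      - apply continuous_ex_RInt; intros y; apply continuous_mult_sine; assumption.
      - intros y Hy; rewrite Rabs_mult, <- (Rmult_1_r B).
        apply Rmult_le_compat; [apply Rabs_pos|apply Rabs_pos|apply Hxm, Hy|apply Hsin]. }
    rewrite (sine_integral_second_derivative L g g1 g2) in HI by assumption.
    rewrite Rabs_mult, Rabs_Ropp, (Rabs_right (_ ^ 2)) in HI
      by (apply Rle_ge, pow2_ge_0).
    rewrite !Rabs_mult, (Rabs_right (2 / L))
      by (apply Rle_ge, Rlt_le, Rdiv_lt_0_compat; lra).
    assert (HJ : Rabs (sine_integral L g m) <= L * B / wavenumber L m ^ 2).
    { apply Rle_div_r; [apply pow_lt, Hk|]; rewrite Rminus_0_r in HI; lra. }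
    replace (D / INR m ^ 2) with (2 / L * (L * B / wavenumber L m ^ 2) * 1)
      by (unfold D, wavenumber; field; lra).
    assert (0 < 2 / L) by (apply Rdiv_lt_0_compat; lra).
    apply Rmult_le_compat; [|apply Rabs_pos| |apply Hsin].
    - apply Rmult_le_pos; [lra|apply Rabs_pos].
    - apply Rmult_le_compat_l; [lra|exact HJ]. }
  assert (Hlim : forall x, 0 <= x <= L ->
            is_lim_seq (fun n => sine_partial_sum L g n x) (g x)).
  { intros x Hx.
    assert (Hends : (forall m, sine L m x = 0) -> g x = 0 ->
              is_lim_seq (fun n => sine_partial_sum L g n x) (g x)).
    { intros Hs ->; apply is_lim_seq_ext with (fun _ => 0); [|apply is_lim_seq_const].
      intros n; symmetry; apply sine_partial_sum_at_node, Hs. }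
    destruct (Req_dec_T x 0) as [->|Hx0].
    - apply Hends; [intros m; apply sine_left|exact H0].
    - destruct (Req_dec_T x L) as [->|HxL].
      + apply Hends; [intros m; apply sine_right, HL|exact HL0].
      + apply sine_series_pointwise with (g1 x); [lra|exact Hg|apply Hd1; lra]. }
  assert (Htail : forall n x, (1 <= n)%nat -> 0 <= x <= L ->
            Rabs (sine_partial_sum L g n x - g x) <= D * / INR n).
  { intros n x Hn Hx.
    assert (Hl : is_lim_seq (fun p => Rabs (sine_partial_sum L g (p + n) x
                   - sine_partial_sum L g n x))
                 (Rabs (g x - sine_partial_sum L g n x))).
    { apply (is_lim_seq_abs _ (Finite (g x - sine_partial_sum L g n x))).
      apply is_lim_seq_minus'; [|apply is_lim_seq_const].
      apply -> (is_lim_seq_incr_n (fun p => sine_partial_sum L g p x) n).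
      apply Hlim, Hx. }
    rewrite Rabs_minus_sym.
    change (Rbar_le (Rabs (g x - sine_partial_sum L g n x)) (D * / INR n)).
    apply (is_lim_seq_le (fun p => Rabs (sine_partial_sum L g (p + n) x
                   - sine_partial_sum L g n x)) (fun _ => D * / INR n) _ _) with (2 := Hl);
      [|apply is_lim_seq_const].
    intros p; rewrite Nat.add_comm.
    apply Rle_trans with (1 := inverse_square_tail _ D n p HD Hn (Hterm x)).
    apply Rmult_le_compat_l; [exact HD|].
    assert (0 < / INR (n + p)) by (apply Rinv_0_lt_compat, lt_0_INR; lia); lra. }
  intros eps; pose proof (cond_pos eps) as He.
  destruct (nfloor_ex (D / eps)) as [N HN].
  { apply Rmult_le_pos; [exact HD|apply Rlt_le, Rinv_0_lt_compat, He]. }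
  exists (S N); intros n Hn x Hx.
  apply Rle_lt_trans with (1 := Htail n x ltac:(lia) Hx).
  assert (Hn' : INR N + 1 <= INR n) by (rewrite <- S_INR; apply le_INR; lia).
  pose proof (pos_INR N).
  apply Rlt_div_l; [lra|].
  assert (H1 : D / eps < INR n) by lra.
  apply Rlt_div_l in H1; lra.
Qed.

(** * Solutions of the wave equation *)

Lemma is_derive_clamped (L : R) (f : R -> R) (x d : R) :
  0 < x < L -> is_derive f x d -> is_derive (fun y => f (clamp L y)) x d.
Proof.
  intros Hx; apply is_derive_ext_loc.
  apply filter_imp with (fun y => 0 < y < L).
  - intros y Hy; rewrite clamp_id by lra; reflexivity.
  - apply (locally_interval _ x 0 L); simpl; try lra.
    intros y H1 H2; split; assumption.
Qed.

(** At the two ends a product with [sine L m] vanishes, whatever the other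
    factor, so time derivatives of such products need be computed only at
    interior points. *)
Lemma clamp_cases (L x : R) :
  0 < L -> 0 < clamp L x < L \/ forall m, sine L m (clamp L x) = 0.
Proof.
  intros HL; destruct (clamp_bounds L x) as [H1 H2]; [lra|].
  destruct (Req_dec_T (clamp L x) 0) as [->|Hn0].
  - right; intros m; apply sine_left.
  - destruct (Req_dec_T (clamp L x) L) as [->|HnL]; [|left; lra].
    right; intros m; apply sine_right, HL.
Qed.

(** The part of the hypotheses on [F] that the argument uses, with named
    derivatives: [F1], [F2] are the continuous extensions to the closed strip
    of the first two space derivatives, and [Ft] is the time derivative inside
    the strip. Its
    behaviour at the ends has to be derived. *)
Record classical_solution (a L : R) (F F1 F2 Ft : R -> R -> R) : Prop := {
  cs_continuous : continuous_on_strip L F;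
  cs_continuous1 : continuous_on_strip L F1;
  cs_continuous2 : continuous_on_strip L F2;
  cs_space1 : forall x t, 0 < x < L -> is_derive (fun y => F y t) x (F1 x t);
  cs_space2 : forall x t, 0 < x < L -> is_derive (fun y => F1 y t) x (F2 x t);
  cs_time1 : forall x t, 0 < x < L -> is_derive (F x) t (Ft x t);
  cs_time2 : forall x t, 0 < x < L -> is_derive (Ft x) t (a * F2 x t);
  cs_left : forall t, F 0 t = 0;
  cs_right : forall t, F L t = 0
}.

Lemma wave_solution_classical (T mu L : R) (F : R -> R -> R) :
  wave_solution T mu L F ->
  exists F1 F2 Ft, classical_solution (T / mu) L F F1 F2 Ft.
Proof.
  intros [[[HF [Hsm Hext]] Hbd] Hw].
  destruct (Hext 1%nat) as [r1 [Hr1 E1]]; destruct (Hext 2%nat) as [r2 [Hr2 E2]].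
  exists r1, r2, (fun x => Derive (F x)); split; try assumption.
  - intros x t Hx; rewrite E1 by exact Hx; apply Derive_correct.
    destruct (Hsm 1%nat x t Hx) as [_ [H _]]; exact H.
  - intros x t Hx; rewrite E2 by exact Hx.
    apply (is_derive_ext_loc (fun y => Derive (fun z => F z t) y)).
    + apply (locally_interval _ x 0 L); simpl; try lra.
      intros y H1 H2; symmetry; apply E1; split; assumption.
    + apply Derive_correct.
      destruct (Hsm 2%nat x t Hx) as [_ [_ [_ [[_ [H _]] _]]]]; exact H.
  - intros x t Hx; apply Derive_correct.
    destruct (Hsm 1%nat x t Hx) as [_ [_ [H _]]]; exact H.
  - intros x t Hx; rewrite E2, <- Hw by exact Hx; apply Derive_correct.
    destruct (Hsm 2%nat x t Hx) as [_ [_ [_ [_ [_ [_ [H _]]]]]]]; exact H.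
  - intros t; apply Hbd.
  - intros t; apply Hbd.
Qed.

Lemma clamped_slice_continuous (L : R) (G : R -> R -> R) (t x : R) :
  0 < L -> continuous_on_strip L G -> continuous (fun y => G (clamp L y) t) x.
Proof.
  intros HL HG; apply (continuous_slice (fun y s => G (clamp L y) s)).
  apply continuous_clamped; [lra|exact HG].
Qed.

Lemma fourier_coef_clamped (L : R) (F : R -> R -> R) (m : nat) (t : R) :
  0 < L ->
  fourier_coef L F m t = 2 / L * sine_integral L (fun x => F (clamp L x) t) m.
Proof.
  intros HL; unfold fourier_coef, sine_integral; f_equal; apply RInt_ext_on; [lra|].
  intros x Hx; rewrite clamp_id by lra; reflexivity.
Qed.

Lemma sine_integral_laplacian (a L : R) (F F1 F2 Ft : R -> R -> R) (m : nat) (t : R) :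
  0 < L -> classical_solution a L F F1 F2 Ft ->
  sine_integral L (fun x => F2 (clamp L x) t) m
  = - wavenumber L m ^ 2 * sine_integral L (fun x => F (clamp L x) t) m.
Proof.
  intros HL HF; destruct HF.
  apply sine_integral_second_derivative with (g1 := fun x => F1 (clamp L x) t);
    try (intros x; apply clamped_slice_continuous; assumption).
  - exact HL.
  - intros x Hx; rewrite (clamp_id L x) by lra.
    apply (is_derive_clamped L (fun y => F y t)); auto.
  - intros x Hx; rewrite (clamp_id L x) by lra.
    apply (is_derive_clamped L (fun y => F1 y t)); auto.
  - rewrite clamp_id by lra; auto.
  - rewrite clamp_id by lra; auto.
Qed.

Lemma fourier_series_uniform (a L : R) (F F1 F2 Ft : R -> R -> R) (t : R) :
  0 < L -> classical_solution a L F F1 F2 Ft ->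
  converges_uniformly_on (fun x => 0 <= x <= L)
    (fun n x => sum_n_m (fun m => fourier_term L F m x t) 1 n) (fun x => F x t).
Proof.
  intros HL HF eps; destruct HF.
  destruct (sine_series_uniform L (fun x => F (clamp L x) t)
    (fun x => F1 (clamp L x) t) (fun x => F2 (clamp L x) t) HL)
    with (eps := eps) as [N HN];
    try (intros x; apply clamped_slice_continuous; assumption).
  - intros x Hx; rewrite (clamp_id L x) by lra.
    apply (is_derive_clamped L (fun y => F y t)); auto.
  - intros x Hx; rewrite (clamp_id L x) by lra.
    apply (is_derive_clamped L (fun y => F1 y t)); auto.
  - rewrite clamp_id by lra; auto.
  - rewrite clamp_id by lra; auto.
  - exists N; intros n Hn x Hx; specialize (HN n Hn x Hx); cbv beta in HN.
    rewrite (clamp_id L x Hx) in HN.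
    rewrite (sum_n_m_ext _ (fun m =>
      2 / L * sine_integral L (fun x => F (clamp L x) t) m * sine L m x)).
    + exact HN.
    + intros m; unfold fourier_term; rewrite fourier_coef_clamped by exact HL; reflexivity.
Qed.

Lemma continuous_clamped_mult_sine (L : R) (G : R -> R -> R) (m : nat) (p : R * R) :
  0 < L -> continuous_on_strip L G ->
  continuous (fun p => G (clamp L (fst p)) (snd p) * sine L m (clamp L (fst p))) p.
Proof.
  intros HL HG.
  apply (continuous_scal (fun p => G (clamp L (fst p)) (snd p))
           (fun p => sine L m (clamp L (fst p)))).
  - apply continuous_clamped; [lra|exact HG].
  - destruct p as [x t].
    apply (continuous_comp fst (fun y => sine L m (clamp L y)));
      [apply continuous_fst|].
    apply (continuous_comp (clamp L) (sine L m));
      [apply continuous_clamp|apply continuous_sine, HL].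
Qed.

(** Differentiating twice under the integral sign replaces [F] by
    [a * F2], by the wave equation, and Green's formula brings the integral
    back to [F]. The integrand is multiplied by the sine before it is clamped,
    so that it is twice differentiable in time at the ends too. *)
Lemma fourier_coef_oscillates (a L : R) (F F1 F2 Ft : R -> R -> R) (m : nat) :
  0 < L -> classical_solution a L F F1 F2 Ft ->
  exists f1 : R -> R,
    (forall t, is_derive (fourier_coef L F m) t (f1 t)) /\
    (forall t, is_derive f1 t (- (a * wavenumber L m ^ 2) * fourier_coef L F m t)).
Proof.
  intros HL HF.
  set (s := fun x => sine L m (clamp L x)).
  set (u := fun x t => F (clamp L x) t * s x).
  set (u1 := fun x t => Ft (clamp L x) t * s x).
  set (u2 := fun x t => a * (F2 (clamp L x) t * s x)).
  assert (Hu : forall p, continuous (fun p : R * R => u (fst p) (snd p)) p).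
  { intros p; apply continuous_clamped_mult_sine, HF; exact HL. }
  assert (Hu2 : forall p, continuous (fun p : R * R => u2 (fst p) (snd p)) p).
  { intros p.
    apply (continuous_scal (fun _ => a)
      (fun p : R * R => F2 (clamp L (fst p)) (snd p) * s (fst p)));
      [apply continuous_const|apply continuous_clamped_mult_sine, HF; exact HL]. }
  assert (Hmul : forall (f : R -> R) (t d c : R), is_derive f t d ->
             is_derive (fun r => f r * c) t (d * c)).
  { intros f t d c Hd; rewrite Rmult_comm.
    apply is_derive_ext with (fun r => c * f r); [intros r; apply Rmult_comm|].
    apply is_derive_scal, Hd. }
  assert (Hzero : forall (f : R -> R) t x, s x = 0 -> is_derive (fun r => f r * s x) t 0).
  { intros f t x Hx; rewrite Hx.
    apply is_derive_ext with (fun _ => 0); [intros r; symmetry; apply Rmult_0_r|].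
    apply (is_derive_const (V := R_NormedModule)). }
  assert (Hd1 : forall x t, is_derive (u x) t (u1 x t)).
  { intros x t; destruct (clamp_cases L x HL) as [Hx|Hx].
    - apply Hmul, HF, Hx.
    - specialize (Hx m); fold (s x) in Hx.
      replace (u1 x t) with 0 by (unfold u1; rewrite Hx; ring).
      apply Hzero, Hx. }
  assert (Hd2 : forall x t, is_derive (u1 x) t (u2 x t)).
  { intros x t; destruct (clamp_cases L x HL) as [Hx|Hx].
    - unfold u2; rewrite <- Rmult_assoc.
      apply (Hmul (Ft (clamp L x))), HF, Hx.
    - specialize (Hx m); fold (s x) in Hx.
      replace (u2 x t) with 0 by (unfold u2; rewrite Hx; ring).
      apply Hzero, Hx. }
  pose proof (continuous_time_derivative u u1 u2 Hu Hu2 Hd1 Hd2) as Hu1.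
  assert (Hs : forall x, 0 < x < L -> s x = sine L m x)
    by (intros x Hx; unfold s; rewrite clamp_id by lra; reflexivity).
  assert (Hf : forall t, 2 / L * RInt (fun x => u x t) 0 L = fourier_coef L F m t).
  { intros t; rewrite fourier_coef_clamped by exact HL; unfold sine_integral; f_equal.
    apply RInt_ext_on; [lra|].
    intros x Hx; unfold u; rewrite Hs by exact Hx; reflexivity. }
  assert (Hf2 : forall t, 2 / L * RInt (fun x => u2 x t) 0 L
                = - (a * wavenumber L m ^ 2) * fourier_coef L F m t).
  { intros t; rewrite fourier_coef_clamped by exact HL.
    replace (RInt (fun x => u2 x t) 0 L)
      with (a * sine_integral L (fun x => F2 (clamp L x) t) m).
    - rewrite (sine_integral_laplacian a L F F1 F2 Ft) by assumption; ring.
    - unfold sine_integral, u2; rewrite <- RInt_Rmult_l.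
      + apply RInt_ext_on; [lra|].
        intros x Hx; rewrite Hs by exact Hx; reflexivity.
      + intros x; apply continuous_mult_sine; [exact HL|].
        intros y; apply clamped_slice_continuous, HF; exact HL. }
  exists (fun t => 2 / L * RInt (fun x => u1 x t) 0 L); split; intros t.
  - apply is_derive_ext with (1 := Hf).
    apply is_derive_scal, is_derive_RInt_time; assumption.
  - rewrite <- Hf2.
    apply is_derive_scal, is_derive_RInt_time; assumption.
Qed.

Theorem lemma0p16 (T M L mu : R) (hT : 0 < T) (hM : 0 < M) (hL : 0 < L)
    (hmu : mu = M / L) (F : R -> R -> R) (hF : wave_solution T mu L F) :
  exists K Lc : nat -> R,
    (forall (m : nat), (1 <= m)%nat -> forall x t : R,
        fourier_term L F m x t = standing_wave T mu L (K m) (Lc m) m x t) /\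
    (forall t : R,
        converges_uniformly_on (fun x => 0 <= x <= L)
          (fun n x => sum_n_m (fun m => standing_wave T mu L (K m) (Lc m) m x t) 1 n)
          (fun x => F x t)).
Proof.
  destruct (wave_solution_classical T mu L F hF) as [F1 [F2 [Ft HF]]].
  assert (Hmu : 0 < mu) by (rewrite hmu; apply Rdiv_lt_0_compat; assumption).
  pose proof (sqrt_lt_R0 T hT) as HsT; pose proof (sqrt_lt_R0 mu Hmu) as Hsmu.
  set (w := fun m => PI * INR m * sqrt T / (L * sqrt mu)).
  assert (Hterm : forall m, (1 <= m)%nat -> forall x t,
    fourier_term L F m x t
    = standing_wave T mu L (fourier_coef L F m 0)
        (Derive (fourier_coef L F m) 0 / w m) m x t).
  { intros m Hm x t.
    destruct (fourier_coef_oscillates (T / mu) L F F1 F2 Ft m hL HF) as [f1 [H1 H2]].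
    assert (Hw : 0 < w m).
    { apply Rdiv_lt_0_compat; [|nra].
      pose proof (lt_0_INR m ltac:(lia)); pose proof PI_RGT_0.
      apply Rmult_lt_0_compat; [nra|exact HsT]. }
    assert (Hw2 : w m ^ 2 = T / mu * wavenumber L m ^ 2).
    { replace (T / mu) with (sqrt T ^ 2 / sqrt mu ^ 2)
        by (rewrite !pow2_sqrt by lra; reflexivity).
      unfold w, wavenumber; field; lra. }
    rewrite <- Hw2 in H2.
    assert (Hosc := harmonic_oscillator (fourier_coef L F m) f1 (w m) Hw H1 H2 t).
    rewrite (is_derive_unique _ _ _ (H1 0)).
    unfold fourier_term, standing_wave; rewrite Hosc.
    replace (PI * INR m * sqrt T * t / (L * sqrt mu)) with (w m * t)
      by (unfold w; field; lra).
    ring. }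
  (* initial position and initial velocity of each oscillator; the rank 0,
     where the frequency vanishes, does not occur in the series *)
  exists (fun m => fourier_coef L F m 0),
    (fun m => Derive (fourier_coef L F m) 0 / w m); split; [exact Hterm|].
  intros t eps.
  destruct (fourier_series_uniform (T / mu) L F F1 F2 Ft t hL HF eps) as [N HN].
  exists N; intros n Hn x Hx.
  rewrite (sum_n_m_ext_loc _ (fun m => fourier_term L F m x t)).
  - exact (HN n Hn x Hx).
  - intros m Hm; symmetry; apply Hterm; lia.
Qed.
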